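(* Let $f\in \mathbb{Z}[t]$ be a quadratic polynomial. Then there is a constant $c>0$ such that there are polynomials $g\in \mathbb{Z}[t]$ of arbitrarily large odd degree $k$ for which $f(g(t))$ factors as a product of polynomials of degree at most $ck/\sqrt{\log\log k}$. Consequently, $f$ admits polysmoothness $\varepsilon$ for every $\varepsilon>0$.
   Context: A polynomial $f\in\mathbb{Z}[t]$ of positive degree admits polysmoothness $\theta$ (for a real $\theta\ge 0$) if there exists a non-constant polynomial $g\in\mathbb{Z}[t]$ such that every irreducible factor of $f(g(t))$ has degree at most $\theta\,(\deg f)(\deg g)$. *)

(* Defs.v *)
From mathcomp Require Import all_boot all_algebra.
From Stdlib Require Import Reals.
Set Implicit Arguments. Unset Strict Implicit. Unset Printing Implicit Defensive.
Import GRing.Theory.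

Definition pdeg {Rg : nzRingType} (p : {poly Rg}) : nat := (size p).-1.

Definition poly_ZQ (p : {poly int}) : {poly rat} := map_poly (@intmul rat 1) p.

(* Every irreducible factor of h (irreducibility over Q; by Gauss's lemma the
   non-constant irreducible factors in Z[t] are exactly the primitive Z-versions
   of these) has degree at most B. *)
Definition irr_factors_deg_le (h : {poly int}) (B : R) : Prop :=
  forall q : {poly rat}, irreducible_poly q -> dvdp q (poly_ZQ h) ->
    (INR (pdeg q) <= B)%R.

Definition admits_polysmoothness (f : {poly int}) (theta : R) : Prop :=
  exists g : {poly int}, (0 < pdeg g)%N /\
    irr_factors_deg_le (comp_poly g f) (theta * INR (pdeg f) * INR (pdeg g))%R.

(* Main.v *)
(* Write f = a X^2 + b X + c, D = b^2 - 4 a c, s = 2 a, and let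
   theta = 1 + s sqrt D, theta^k = x + y sqrt D with k odd and k = 1 mod s.
   Since s divides y and theta has norm prime to s y, some integer r satisfies
   r^k = b y - x mod s y. Hence, with T = s y t + r, the polynomial
   g = (T^k + x - b y) / (s y) has integer coefficients, and
     4 a y^2 f(g) = (T^k + x)^2 - D y^2 = (T^k + theta^k) (T^k + conj(theta)^k)
   splits into homogenised cyclotomic factors in T, of degree at most 2 phi(k)
   after taking norms to Q. Taking k = prod_(j < n) (1 + A j) with A = |s|, the
   identity k = sum_(d | k) phi(d) >= phi(k) sum_(j < n) 1 / (1 + A j) gives
   phi(k) / k = O(1 / log n), while log log k = O(log n). *)

Require Import Defs.
From mathcomp Require Import all_boot all_algebra all_field.
From mathcomp Require Import ring zify.
Set Implicit Arguments. Unset Strict Implicit. Unset Printing Implicit Defensive.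
Import GRing.Theory Num.Theory.

(** * Totient inequalities and Gauss's divisor sum *)

Lemma totient_prime_mul (p b : nat) : prime p ->
  totient b <= totient (p * b) <= p * totient b.
Proof.
move=> p_pr; have p_gt0 := prime_gt0 p_pr; have p_gt1 := prime_gt1 p_pr.
have [->|b_gt0] := posnP b; first by rewrite muln0.
have [p_dvd|p_ndvd] := boolP (p %| b); last first.
  rewrite totient_coprime ?prime_coprime // (totient_prime p_pr).
  by case: p p_gt1 {p_pr p_gt0 p_ndvd} => [|[|p]] // _; rewrite leq_pmull // leq_mul2r leqnSn orbT.
have [m cop_pm def_b] := pfactor_coprime p_pr b_gt0.
have e_gt0 : 0 < logn p b by rewrite logn_gt0 mem_primes p_pr b_gt0.
move: (logn p b) e_gt0 def_b => e e_gt0 ->.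
rewrite mulnCA -expnS !totient_coprime ?coprimeXr //; try by rewrite coprime_sym.
rewrite !totient_pfactor //= -[e in X in _ <= X <= _]prednK // expnS.
by rewrite [p.-1 * (p * _)]mulnCA [in X in _ <= X <= _]mulnCA leq_pmull ?leqnn.
Qed.

(** Strip one prime [p] at a time from [a]: each multiplies the totient by [p] or by [p - 1],
    according to whether [p] divides the other factor. *)
Lemma totient_mul_bounds (a b : nat) : 0 < a ->
  totient b <= totient (a * b) <= a * totient b.
Proof.
elim/ltn_ind: a b => a IH b a_gt0.
have [a_le1|a_gt1] := leqP a 1.
  by rewrite (_ : a = 1%N) ?mul1n ?leqnn //; lia.
have p_pr := pdiv_prime a_gt1; have p_gt1 := prime_gt1 p_pr.
set p := pdiv a in p_pr p_gt1; have def_a : a = p * (a %/ p) by rewrite mulnC divnK ?pdiv_dvd.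
have a'_gt0 : 0 < a %/ p by rewrite divn_gt0 ?prime_gt0 // dvdn_leq ?pdiv_dvd.
have a'_lt : a %/ p < a by rewrite ltn_Pdiv.
move: (IH _ a'_lt b a'_gt0) (totient_prime_mul ((a %/ p) * b) p_pr).
by rewrite mulnA -def_a; move: (totient _) (totient _) (totient _) => x y z; nia.
Qed.

Lemma leq_totient_dvd (d n : nat) : 0 < n -> d %| n -> totient d <= totient n.
Proof.
move=> n_gt0 /dvdnP[e def_n]; rewrite def_n.
have e_gt0 : 0 < e by lia.
by have /andP[] := @totient_mul_bounds e d e_gt0.
Qed.

(** Compares degrees in [X^n - 1 = prod_(d | n) Phi_d]; sizes exceed degrees by one, hence the
    initial [succn_inj]. *)
Lemma sum_totient_divisors (n : nat) : 0 < n -> \sum_(d <- divisors n) totient d = n.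
Proof.
move=> n_gt0; apply: succn_inj.
transitivity (size (\prod_(d <- divisors n) 'Phi_d)%R); last first.
  by rewrite prod_Cyclotomic // size_XnsubC.
rewrite size_prod_seq /=; last by move=> d _; rewrite monic_neq0 ?Cyclotomic_monic.
under [in RHS]eq_bigr do rewrite size_Cyclotomic -addn1.
by rewrite big_split /= sum1_size; lia.
Qed.

(** * Products of an arithmetic progression *)

Definition prog_prod (A n : nat) := \prod_(j < n) (1 + A * j).

Lemma prog_prod_gt0 (A n : nat) : 0 < prog_prod A n.
Proof. by rewrite prodn_gt0. Qed.

Lemma dvdn_prog_prod (A n j : nat) : j < n -> 1 + A * j %| prog_prod A n.
Proof.
by move=> lt_jn; rewrite /prog_prod (bigD1 (Ordinal lt_jn)) //= dvdn_mulr.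
Qed.

(** The quotients [k / (1 + A j)] are pairwise distinct divisors of [k], so this is a subsum of
    Gauss's sum over all divisors. *)
Lemma sum_totient_prog (A n : nat) : 0 < A ->
  \sum_(j < n) totient (prog_prod A n %/ (1 + A * j)) <= prog_prod A n.
Proof.
move=> A_gt0; set k := prog_prod A n; have k_gt0 : 0 < k := prog_prod_gt0 A n.
pose s := [seq k %/ (1 + A * j) | j <- iota 0 n].
have s_uniq : uniq s.
  rewrite map_inj_in_uniq ?iota_uniq // => i j.
  rewrite !mem_iota !add0n /=.
  move=> /(@dvdn_prog_prod A) di /(@dvdn_prog_prod A) dj eq_ij; rewrite -/k in di dj.
  have : (1 + A * i) * (k %/ (1 + A * j)) = (1 + A * j) * (k %/ (1 + A * j)).
    by rewrite -{1}eq_ij ![(1 + A * _) * _]mulnC !divnK.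
  have qj_gt0 : 0 < k %/ (1 + A * j) by rewrite divn_gt0 // dvdn_leq.
  by move/eqP; rewrite eqn_pmul2r // eqn_add2l eqn_pmul2l // => /eqP.
rewrite -{2}(sum_totient_divisors k_gt0).
rewrite -(big_mkord xpredT (fun j => totient (k %/ (1 + A * j)))) /index_iota subn0.
rewrite -(big_map (fun j => k %/ (1 + A * j)) xpredT totient).
apply: (@uniq_sub_le_big nat addn leq leqnn (fun x y => leq_addr y x) 0) => //.
  exact: divisors_uniq.
move=> d /mapP[j]; rewrite mem_iota add0n /= => /(@dvdn_prog_prod A) dj ->.
by rewrite -dvdn_divisors // dvdn_div.
Qed.

Lemma prog_prod_mod (A n : nat) : exists w, prog_prod A n = (A * w).+1.
Proof.
elim: n => [|n [w IH]]; first by exists 0; rewrite /prog_prod big_ord0 muln0.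
exists (w + n * (A * w).+1); rewrite /prog_prod big_ord_recr /= -/(prog_prod A n) IH.
by rewrite [in LHS]mulnDr muln1 mulnCA [in RHS]mulnDr -addSn [(_).+1 * n]mulnC.
Qed.

(** * Powers of [1 + s sqrt D] and twisted cyclotomic polynomials *)

Section Algebra.
Local Open Scope ring_scope.

(** Coordinates of [(1 + s sqrt D)^j] in the basis [1, sqrt D], kept integral so that congruences
    can be stated. *)
Fixpoint quad_pow (s D : int) (j : nat) : int * int :=
  if j is j'.+1 then
    let p := quad_pow s D j' in (p.1 + s * D * p.2, s * p.1 + p.2)
  else (1, 0).

Lemma quad_powE (R : comNzRingType) (delta : R) (s D : int) (j : nat) :
  delta ^+ 2 = D%:~R ->
  (1 + s%:~R * delta) ^+ j =
    (quad_pow s D j).1%:~R + (quad_pow s D j).2%:~R * delta.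
Proof.
move=> deltaE; elim: j => [|j IH] /=; first by rewrite expr0 mul0r addr0.
by rewrite exprS IH !rmorphD !rmorphM /= -deltaE; ring.
Qed.

Lemma quad_pow_norm (s D : int) (j : nat) :
  (quad_pow s D j).1 ^+ 2 - D * (quad_pow s D j).2 ^+ 2 = (1 - s ^+ 2 * D) ^+ j.
Proof.
elim: j => [|j IH] /=; first by rewrite expr0; ring.
by rewrite [RHS]exprS -IH; ring.
Qed.

Lemma quad_pow_mod (s D : int) (j : nat) : exists u v : int,
  (quad_pow s D j).1 = 1 + s * u /\ (quad_pow s D j).2 = s * (j%:Z + s * v).
Proof.
elim: j => [|j [u [v [/= -> ->]]]]; first by exists 0, 0; split => /=; ring.
exists (u + D * (s * (j%:Z + s * v))), (u + v).
by rewrite -addn1 PoszD; split; ring.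
Qed.

(** [theta = 1 + s sqrt D] has trace 2 and norm [N = 1 - s^2 D], so [theta^2 = 2 theta - N] and
    [theta^(j+1)] is [2^j theta] modulo [N]. This yields that [N] is prime to [y]. *)
Lemma quad_pow_mod_norm (s D : int) (j : nat) : exists w : int,
  (quad_pow s D j.+1).2 = 2 ^+ j * s + (1 - s ^+ 2 * D) * w.
Proof.
suff [v [w [_ ->]]] : exists v w : int,
    (quad_pow s D j.+1).1 = 2 ^+ j + (1 - s ^+ 2 * D) * v /\
    (quad_pow s D j.+1).2 = 2 ^+ j * s + (1 - s ^+ 2 * D) * w by exists w.
elim: j => [|j [v [w [IH1 IH2]]]].
  by exists 0, 0; rewrite /= expr0; split; ring.
set N := 1 - _ in IH1 IH2 *.
exists (v - 2 ^+ j + s * D * w), (s * v + w).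
rewrite exprS; move: IH1 IH2 => /=; set p := quad_pow s D j => -> ->.
by rewrite /N; split; ring.
Qed.

(* [x ^ 2 = N ^ k] modulo [s y] for the norm [N = 1 - s ^ 2 D], and [s y] divides [y ^ 2];
   hence [r = - x N ^- m (1 - b y)] works. *)
Lemma kth_root_mod (s b D : int) (m : nat) (k := (2 * m).+1%N)
    (x := (quad_pow s D k).1) (y := (quad_pow s D k).2) :
  (2 %| s)%Z -> (k%:Z = 1 %[mod s])%Z ->
  exists r : int, (r ^+ k + x = b * y %[mod s * y])%Z.
Proof.
move=> s_even k1.
set N := 1 - s ^+ 2 * D; set M := s * y.
have [x' [y' [xE yE]]] := quad_pow_mod s D k; rewrite -/x -/y in xE yE.
have cop_N : coprimez N M.
  have [w] := quad_pow_mod_norm s D (2 * m); rewrite -/k -/y -/N => yN.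
  have cop_s : coprimez N s by apply/coprimezP; exists (1, s * D); rewrite /N /=; ring.
  have cop_2 : coprimez N 2.
    move: cop_s; have /dvdzP[q ->] := s_even.
    by rewrite coprimezMr => /andP[].
  rewrite coprimezMr cop_s yN /coprimez addrC mulrC gcdzMDl -/(coprimez _ _).
  by rewrite coprimezMr cop_s coprimezXr.
(* [u] is the inverse of [N] modulo [M], and [E] below is congruence modulo [M]. *)
have /coprimezP[[u v] /= uv] := cop_N.
pose E (p q : int) := (M %| p - q)%Z.
have Erefl p : E p p by rewrite /E subrr dvdz0.
have Etrans p q r : E p q -> E q r -> E p r.
  by move=> pq qr; rewrite /E -(subrK q p) -addrA; apply: rpredD.
have EM p p' q q' : E p p' -> E q q' -> E (p * q) (p' * q').
  move=> pp qq; rewrite /E (_ : p * q - p' * q' = (p - p') * q + p' * (q - q')); last by ring.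
  by apply: rpredD; [apply: dvdz_mulr | apply: dvdz_mull].
have ED p p' q : E p p' -> E (p + q) (p' + q).
  by rewrite /E (_ : p + q - (p' + q) = p - p'); last by ring.
have EX p p' n : E p p' -> E (p ^+ n) (p' ^+ n).
  by move=> pp; elim: n => // n IH; rewrite !exprS; apply: (EM).
have Eeq p q w : p - q = M * w -> E p q by rewrite /E => ->; apply: dvdz_mulr.
exists (- x * u ^+ m * (1 - b * y)).
have E_xu : E (x ^+ k * (u ^+ m) ^+ k) x.
  have -> : x ^+ k * (u ^+ m) ^+ k = x * ((x ^+ 2) ^+ m * (u ^+ k) ^+ m).
    by rewrite -!exprM [(k * m)%N]mulnC mulrA -exprS.
  rewrite -[X in E _ X]mulr1; apply: (EM) => //.
  apply: (Etrans _ ((N ^+ k) ^+ m * (u ^+ k) ^+ m)).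
    (* [x^2 - N^k = D y^2], and [y = s (k + s y')] makes [y^2] a multiple of [M = s y]. *)
    apply: (EM) => //; apply: (EX); apply: (Eeq _ _ (D * (k%:Z + s * y'))).
    rewrite -(quad_pow_norm s D k) -/x -/y /M.
    by transitivity (D * (y * y)); [ring | rewrite {1}yE; ring].
  rewrite -exprMn -exprMn -[X in E _ X](expr1n _ m) -[X in E _ (X ^+ m)](expr1n _ k).
  do 2!apply: (EX); apply: (Eeq _ _ (- v)).
  by rewrite -uv; ring.
(* The binomial expansion stops at the linear term because [M] divides [y^2]. *)
have E_by n : E ((1 - b * y) ^+ n) (1 - n%:Z * b * y).
  elim: n => [|n IH]; first by rewrite expr0 !mul0r subr0.
  rewrite exprS; apply: (Etrans _ ((1 - b * y) * (1 - n%:Z * b * y))); first exact: EM.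
  apply: (Eeq _ _ (n%:Z * b ^+ 2 * (k%:Z + s * y'))).
  rewrite /M -addn1 PoszD.
  by transitivity (n%:Z * b ^+ 2 * (y * y)); [ring | rewrite {1}yE; ring].
have /eqP := k1; rewrite eqz_mod_dvd => /dvdzP[q kE].
have rk : (- x * u ^+ m * (1 - b * y)) ^+ k =
    - (x ^+ k * (u ^+ m) ^+ k) * (1 - b * y) ^+ k.
  have xN : (- x) ^+ k = - x ^+ k by rewrite exprNn -signr_odd /k /= mul2n odd_double mulN1r.
  by rewrite 2!exprMn xN !mulNr.
apply/eqP; rewrite eqz_mod_dvd -/M.
apply: (Etrans _ (- x * (1 - k%:Z * b * y) + x)).
  by rewrite rk; apply: ED; apply: (EM) => //; rewrite /E -opprD rpredN.
(* What remains is [b y (k x - 1)], a multiple of [s y] since [k] and [x] are both 1 modulo [s]. *)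
apply: (Eeq _ _ (b * (k%:Z * x' + q))).
have kE' : k%:Z = q * s + 1 by rewrite -kE subrK.
by rewrite /M xE kE'; ring.
Qed.

(* Writing the homogenised cyclotomic polynomial [theta ^ d Phi_n(X / theta)] as [A + delta B]
   with integer [A] and [B], take [P = A ^ 2 - D B ^ 2]. *)
Lemma root_twisted_cyclotomic (delta zeta : algC) (s D : int) (n : nat) :
  delta ^+ 2 = D%:~R -> n.-primitive_root zeta ->
  exists2 P : {poly int}, size P = (2 * totient n).+1%N &
    root (map_poly intr P) ((1 + s%:~R * delta) * zeta).
Proof.
move=> deltaE prim_zeta; set theta := 1 + _; set d := totient n.
have d_gt0 : (0 < d)%N by rewrite totient_gt0 (prim_order_gt0 prim_zeta).
pose coefs (h : int * int -> int) : {poly int} :=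
  \poly_(i < d.+1) ('Phi_n`_i * h (quad_pow s D (d - i))).
pose A := coefs fst; pose B := coefs snd.
have lead_Phi : 'Phi_n`_d = 1.
  by have /monicP := Cyclotomic_monic n; rewrite lead_coefE size_Cyclotomic.
have size_A : size A = d.+1.
  by rewrite size_poly_eq // subnn lead_Phi mul1r oner_eq0.
(* The top coefficient uses [theta^0 = 1], with coordinates [(1, 0)]: it is 1 in [A] and 0 in [B],
   so [A^2 - D B^2] has degree exactly [2 d]. *)
have size_B : (size B <= d)%N.
  apply/leq_sizeP => j le_dj; rewrite coef_poly ltnS.
  case: leqP => // ge_dj; have -> : j = d by apply/eqP; rewrite eqn_leq ge_dj.
  by rewrite subnn mulr0.
have horner_coefs h (x : algC) : (map_poly intr (coefs h)).[x] =
    \sum_(i < d.+1) ('Phi_n`_i)%:~R * (h (quad_pow s D (d - i)))%:~R * x ^+ i.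
  rewrite (@horner_coef_wide _ d.+1); last first.
    by apply: leq_trans (size_poly _ _) (size_poly _ _).
  apply: eq_bigr => i _; rewrite coef_map /= coef_poly ltn_ord.
  by rewrite rmorphM.
exists (A ^+ 2 - D *: B ^+ 2).
  have size_A2 : size (A ^+ 2) = (2 * d).+1%N.
    have A_neq0 : A != 0 by rewrite -size_poly_eq0 size_A.
    have := size_exp A 2; rewrite size_A mulnC => <-.
    by rewrite prednK // size_poly_gt0 expf_neq0.
  rewrite size_polyDl // size_A2 size_polyN (leq_ltn_trans (size_scale_leq _ _)) //.
  rewrite (leq_ltn_trans (size_poly_exp_leq _ _)) //.
  by rewrite ltnS mulnC ltn_mul2l /=; move: size_B; case: (size _).
rewrite /root rmorphB /= map_polyZ /= !rmorphXn /= hornerD hornerN hornerZ !horner_exp.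
(* The left side is [theta^d Phi_n(zeta)]. *)
have rootAB : (map_poly intr A).[theta * zeta] + delta * (map_poly intr B).[theta * zeta] = 0.
  have := prim_zeta; rewrite -(root_cyclotomic prim_zeta) -(Cintr_Cyclotomic prim_zeta).
  move=> /rootP Phi0; rewrite -[RHS](mulr0 (theta ^+ d)) -Phi0 !horner_coefs.
  rewrite (@horner_coef_wide _ d.+1); last first.
    by rewrite (leq_trans (size_poly _ _)) ?size_Cyclotomic.
  have expand (R : comNzRingType) (x y u c t z : R) :
      c * x * (t * z) + u * (c * y * (t * z)) = (x + y * u) * t * (c * z) by ring.
  rewrite mulr_sumr -big_split mulr_sumr /=; apply: eq_bigr => i _.
  rewrite coef_map /= exprMn.
  have -> : theta ^+ d = theta ^+ (d - i) * theta ^+ i by rewrite -exprD subnK // -ltnS.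
  rewrite [theta ^+ (d - i)](quad_powE s (d - i) deltaE).
  exact: expand.
by move/eqP: rootAB; rewrite addr_eq0 => /eqP ->; rewrite sqrrN exprMn deltaE subrr.
Qed.

(** Otherwise [q] and [P] would be coprime over the rationals, hence over [algC], which forbids the
    common root [beta]; so [q] divides [P]. *)
Lemma size_irreducible_root (q : {poly rat}) (P : {poly int}) (beta : algC) :
  irreducible_poly q -> P != 0 -> root (map_poly ratr q) beta ->
  root (map_poly intr P) beta -> (size q <= size P)%N.
Proof.
move=> q_irr P_neq0 q_beta P_beta.
have size_PQ : size (poly_ZQ P) = size P by rewrite size_map_inj_poly //; apply: intr_inj.
have PQ_neq0 : poly_ZQ P != 0 by rewrite -size_poly_eq0 size_PQ size_poly_eq0.
rewrite -size_PQ dvdp_leq //; apply: contraT.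
rewrite -(irreducible_poly_coprime _ q_irr) -(coprimep_map (@ratr algC)).
move/coprimep_root/(_ q_beta); rewrite /poly_ZQ -map_poly_comp.
rewrite (eq_map_poly (g := intr)) ?(rootP P_beta) ?eqxx //.
by move=> z /=; rewrite ratr_int.
Qed.

(** * The substitution [g] and the factors of [f(g)] *)

Lemma linear_power_congr (M r : int) (k : nat) : exists h : {poly int},
  (M *: 'X + r%:P) ^+ k = M *: h + (r ^+ k)%:P.
Proof.
exists ('X * \sum_(i < k) (M *: 'X + r%:P) ^+ (k.-1 - i) * r%:P ^+ i).
have := subrXX (M *: 'X + r%:P) r%:P k; rewrite addrK -scalerAl => <-.
by rewrite rmorphXn /= subrK.
Qed.

Lemma size_linear (M r : int) : M != 0 -> size (M *: 'X + r%:P) = 2%N.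
Proof.
move=> M_neq0; rewrite size_polyDl size_scale ?size_polyX //.
by rewrite ltnS size_polyC leq_b1.
Qed.

(** For a root [beta] of [q], [- T(beta)] is [theta] times a root of unity of order [n] dividing
    [k]. Hence [beta] is a root of an integer polynomial of degree [2 phi(n) <= 2 phi(k)], which [q]
    divides. *)
Lemma quadratic_factor_bound (f : {poly int}) (m : nat)
    (k := (2 * m).+1%N) (s := f`_2 *+ 2) :
  size f = 3%N -> (k%:Z = 1 %[mod s])%Z ->
  exists2 g : {poly int}, pdeg g = k &
    forall q : {poly rat}, irreducible_poly q -> q %| poly_ZQ (f \Po g) ->
      (pdeg q <= 2 * totient k)%N.
Proof.
move=> size_f k1.
set a := f`_2 in s k1 *; set b := f`_1; set c := f`_0.
have a_neq0 : a != 0.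
  rewrite /a -[2%N]/(3.-1)%N -size_f -lead_coefE lead_coef_eq0.
  by rewrite -size_poly_eq0 size_f.
have sE : s = 2 * a by rewrite mulr_natl.
have s_neq0 : s != 0 by rewrite sE mulf_neq0.
pose D := b ^+ 2 - 4 * a * c.
have s_even : (2 %| s)%Z by rewrite sE dvdz_mulr.
have [r /eqP] := kth_root_mod b D s_even k1.
rewrite -/k; set x := (quad_pow s D k).1; set y := (quad_pow s D k).2; set M := s * y.
rewrite eqz_mod_dvd => /dvdzP[z rE].
(* [y / s] is [k] modulo [s], hence 1 modulo the even number [s], so it is odd. *)
have y_neq0 : y != 0.
  have [u [v [_]]] := quad_pow_mod s D k; rewrite -/y => ->.
  rewrite mulf_neq0 //; have /eqP := k1; rewrite eqz_mod_dvd => /dvdzP[w kE].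
  have -> : k%:Z = w * s + 1 by rewrite -kE subrK.
  by rewrite sE; apply/eqP; lia.
have M_neq0 : M != 0 by rewrite mulf_neq0.
pose T : {poly int} := M *: 'X + r%:P.
have size_T : size T = 2%N by rewrite size_linear.
have [h hE] := linear_power_congr M r k.
pose g := h + z%:P.
have gE : M *: g = T ^+ k + (x - b * y)%:P.
  rewrite scalerDr scale_polyC [M * z]mulrC -rE hE -[RHS]addrA -polyCD.
  by congr (_ + _%:P); ring.
have size_Tk : size (T ^+ k) = k.+1.
  have T_neq0 : T != 0 by rewrite -size_poly_eq0 size_T.
  have := size_exp T k; rewrite size_T mul1n => {2}<-.
  by rewrite prednK // size_poly_gt0 expf_neq0.
have size_g : size g = k.+1.
  rewrite -(size_scale g M_neq0) gE size_polyDl size_Tk //.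
  by rewrite ltnS (leq_trans (size_polyC_leq1 _)).
exists g; first by rewrite /pdeg size_g.
move=> q q_irr q_dvd.
have [beta q_beta] : exists beta : algC, root (map_poly ratr q) beta.
  by apply/closed_rootP; rewrite size_map_poly; case: q_irr => /gtn_eqF ->.
pose gamma := (map_poly intr g).[beta] : algC.
pose tau := (map_poly intr T).[beta] : algC.
have f_gamma : a%:~R * gamma ^+ 2 + b%:~R * gamma + c%:~R = 0.
  have : root (map_poly ratr (poly_ZQ (f \Po g))) beta.
    by have /dvdpP[w ->] := q_dvd; rewrite rmorphM rootM q_beta orbT.
  rewrite /poly_ZQ -map_poly_comp (eq_map_poly (g := intr)); last by move=> i /=; rewrite ratr_int.
  rewrite map_comp_poly /= /root horner_comp -/gamma => /eqP <-.
  rewrite (@horner_coef_wide _ 3); last by rewrite (leq_trans (size_poly _ _)) // size_f.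
  rewrite !big_ord_recl big_ord0 !coef_map /= expr0 mulr1 expr1 addr0.
  by rewrite [RHS]addrC; congr (_ + _); rewrite addrC.
have gamma_tau : M%:~R * gamma = tau ^+ k + (x - b * y)%:~R.
  rewrite /gamma /tau -hornerZ -map_polyZ gE rmorphD rmorphXn /= map_polyC.
  by rewrite hornerD horner_exp hornerC.
have tauE : tau ^+ k + x%:~R = y%:~R * (s%:~R * gamma + b%:~R).
  rewrite mulrDr mulrA -!rmorphM [y * s]mulrC gamma_tau -addrA -rmorphD [y * b]mulrC.
  by rewrite subrK.
pose delta : algC := sqrtC D%:~R.
have deltaE : delta ^+ 2 = D%:~R by rewrite sqrtCK.
have disc : (s%:~R * gamma + b%:~R) ^+ 2 = delta ^+ 2.
  have complete_square (R : comNzRingType) (u v w t : R) :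
      u * t ^+ 2 + v * t + w = 0 -> (2 * u * t + v) ^+ 2 = v ^+ 2 - 4 * u * w.
    move=> uvw.
    transitivity (v ^+ 2 - 4 * u * w + 4 * u * (u * t ^+ 2 + v * t + w)); first by ring.
    by rewrite uvw mulr0 addr0.
  rewrite deltaE sE /D !(rmorphB, rmorphM, rmorphXn) /=.
  exact: complete_square.
(* As [k] is odd, [(- tau)^k = x - y (s gamma + b)]; the suitable square root of [D] is therefore
   [delta' = - (s gamma + b)]. *)
have [delta' [delta'E tau_k]] : exists delta' : algC,
    delta' ^+ 2 = D%:~R /\ (- tau) ^+ k = (1 + s%:~R * delta') ^+ k.
  have k_odd : odd k by rewrite /= mul2n odd_double.
  have opp_k (u : algC) : (- u) ^+ k = - u ^+ k.
    by rewrite exprNn -signr_odd k_odd mulN1r.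
  have : tau ^+ k = y%:~R * (s%:~R * gamma + b%:~R) - x%:~R by rewrite -tauE addrK.
  have /orP[] : (s%:~R * gamma + b%:~R == delta) || (s%:~R * gamma + b%:~R == - delta).
  - by rewrite -eqf_sqr disc.
  - move=> /eqP -> tau_k.
    have deltaNE : (- delta) ^+ 2 = D%:~R by rewrite sqrrN.
    exists (- delta); split => //.
    rewrite (quad_powE s k deltaNE) -/x -/y opp_k tau_k.
    by rewrite opprB mulrN.
  move=> /eqP -> tau_k; exists delta; split => //.
  rewrite (quad_powE s k deltaE) -/x -/y opp_k tau_k.
  by rewrite opprB mulrN opprK.
set theta := 1 + _ in tau_k.
(* The norm [1 - s^2 D] is 1 modulo 4, since [s = 2 a]. *)
have theta_neq0 : theta != 0.
  apply/eqP => theta0.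
  have : (1 - s ^+ 2 * D)%:~R = theta * (1 - s%:~R * delta') :> algC.
    rewrite rmorphB rmorphM rmorphXn /= -delta'E /theta.
    have diff_sq (R : comNzRingType) (u v : R) :
      1 - u ^+ 2 * v ^+ 2 = (1 + u * v) * (1 - u * v) by ring.
    exact: diff_sq.
  rewrite theta0 mul0r => /eqP; rewrite intr_eq0 sE => /eqP.
  move: (D) => D'; nia.
pose zeta := - tau / theta.
have zeta_k : zeta ^+ k = 1.
  by rewrite expr_div_n tau_k divff // expf_neq0.
have [n prim_zeta n_dvd] := prim_order_exists (ltn0Sn _) zeta_k.
have [P size_P P_root] := root_twisted_cyclotomic s delta'E prim_zeta.
have size_NT : size (- T) = 2%N by rewrite size_polyN.
have P_beta : root (map_poly intr (P \Po (- T))) beta.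
  rewrite map_comp_poly /= /root horner_comp rmorphN hornerN -/tau.
  by have -> : - tau = theta * zeta by rewrite mulrC divfK.
have size_PT : size (P \Po (- T)) = (2 * totient n).+1%N by rewrite size_comp_poly2.
have PT_neq0 : P \Po (- T) != 0 by rewrite -size_poly_eq0 size_PT.
have := size_irreducible_root q_irr PT_neq0 q_beta P_beta.
rewrite size_PT /pdeg => le_q.
have le_n : (totient n <= totient k)%N by rewrite leq_totient_dvd.
by rewrite -subn1 leq_subLR add1n (leq_trans le_q) // ltnS leq_mul2l le_n orbT.
Qed.

(** With [A = |s|], all factors [1 + A j] are 1 modulo [s], hence so is their product; it is odd
    because [A] is even. *)
Lemma smooth_substitution (f : {poly int}) : size f = 3%N ->
  exists2 A : nat, (0 < A)%N & forall n : nat,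
    odd (prog_prod A n) /\
    exists2 g : {poly int}, pdeg g = prog_prod A n &
      forall q : {poly rat}, irreducible_poly q -> q %| poly_ZQ (f \Po g) ->
        (pdeg q <= 2 * totient (prog_prod A n))%N.
Proof.
move=> size_f; pose s := f`_2 *+ 2; pose A := `|s|%N.
have A_even : A = (2 * `|(f`_2)%R|)%N by rewrite /A /s -mulr_natl abszM.
exists A => [|n].
  rewrite absz_gt0 mulrn_eq0 /= -[2%N]/(3.-1)%N -size_f -lead_coefE lead_coef_eq0.
  by rewrite -size_poly_eq0 size_f.
have [w kE] := prog_prod_mod A n.
pose m := (`|(f`_2)%R| * w)%N.
have km : prog_prod A n = (2 * m).+1%N by rewrite kE A_even mulnA.
have k_mod : ((2 * m).+1%N%:Z = 1 %[mod s])%Z.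
  apply/eqP; rewrite eqz_mod_dvd -km kE -addn1 PoszD addrK dvdzE /= -/A.
  exact: dvdn_mulr.
by rewrite km mul2n /= odd_double -mul2n; split => //; apply: quadratic_factor_bound.
Qed.

End Algebra.

(* Imported late because it rebinds the scope key %R. *)
From Stdlib Require Import Reals Lra.

(** * Logarithmic estimates for the totient and for [log log k] *)

Lemma leq_INR (m n : nat) : m <= n -> (INR m <= INR n)%R.
Proof. by move/leP/le_INR. Qed.

Lemma INR_mul (m n : nat) : INR (m * n) = (INR m * INR n)%R.
Proof. by rewrite -multE mult_INR. Qed.

Lemma ln_le (x y : R) : (0 < x)%R -> (x <= y)%R -> (ln x <= ln y)%R.
Proof.
move=> x_gt0 [lt_xy|->]; last exact: Rle_refl.
by apply/Rlt_le/ln_increasing.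
Qed.

(** Since [1 + A j <= (A + 1) (j + 1)], the sum of the [(A + 1) u j] is at least [c] times the
    harmonic sum, which dominates [ln (n + 1)]. *)
Lemma ln_le_harmonic_prog (A n : nat) (u : nat -> nat) (c : R) : (0 <= c)%R ->
  (forall j, j < n -> (c <= INR (1 + A * j) * INR (u j))%R) ->
  (c * ln (INR n.+1) <= INR A.+1 * INR (\sum_(j < n) u j))%R.
Proof.
move=> c_ge0; elim: n => [|n IH] u_ge; first by rewrite big_ord0 ln_1 /=; lra.
have -> : \sum_(j < n.+1) u j = (\sum_(j < n) u j + u n)%coq_nat by rewrite big_ord_recr.
rewrite plus_INR.
have IHn : (c * ln (INR n.+1) <= INR A.+1 * INR (\sum_(j < n) u j))%R.
  by apply: IH => j lt_jn; apply: u_ge; apply: ltnW.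
have n1_gt0 : (0 < INR n.+1)%R by apply: lt_0_INR; lia.
(* From [1 + t <= exp t] at [t = 1 / (n + 1)]. *)
have ln_step : (ln (INR n.+2) <= ln (INR n.+1) + / INR n.+1)%R.
  have -> : INR n.+2 = (INR n.+1 * (1 + / INR n.+1))%R by rewrite (S_INR n.+1); field; lra.
  have inv_gt0 := Rinv_0_lt_compat _ n1_gt0.
  rewrite ln_mult; try lra.
  have := @ln_le (1 + / INR n.+1)%R (exp (/ INR n.+1)%R); rewrite ln_exp => H.
  have := exp_ineq1_le (/ INR n.+1)%R => H'.
  have H0 : (0 < 1 + / INR n.+1)%R by lra.
  by have := H H0 H'; lra.
have cu : (c * / INR n.+1 <= INR A.+1 * INR (u n))%R.
  apply: (Rmult_le_reg_r _ _ _ n1_gt0); rewrite Rmult_assoc Rinv_l; last by lra.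
  rewrite Rmult_1_r; apply: Rle_trans (u_ge n (ltnSn n)) _.
  have -> : (INR A.+1 * INR (u n) * INR n.+1 = INR (A.+1 * n.+1) * INR (u n))%R.
    by rewrite INR_mul; ring.
  apply: Rmult_le_compat_r; [exact: pos_INR | apply: leq_INR].
  by rewrite mulSn mulnS !addSn add0n ltnS addnA leq_addl.
have := Rmult_le_compat_l _ _ _ c_ge0 ln_step; lra.
Qed.

(** The harmonic estimate applies with [c = phi(k)] because
    [phi(k) <= (1 + A j) phi(k / (1 + A j))]. *)
Lemma totient_prog_bound (A n : nat) (k := prog_prod A n) : 0 < A ->
  (INR (totient k) * ln (INR n.+1) <= INR A.+1 * INR k)%R.
Proof.
move=> A_gt0.
apply: Rle_trans (Rmult_le_compat_l _ _ _ (pos_INR _) (leq_INR (sum_totient_prog n A_gt0))).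
apply: (@ln_le_harmonic_prog A n (fun j => totient (k %/ (1 + A * j)))); first exact: pos_INR.
move=> j lt_jn; rewrite -INR_mul; apply: leq_INR.
have /andP[_] := @totient_mul_bounds (1 + A * j) (k %/ (1 + A * j)) isT.
by rewrite mulnC divnK // dvdn_prog_prod.
Qed.

Lemma prog_prod_ge (A n : nat) : 0 < A -> n <= prog_prod A n.+1.
Proof.
move=> A_gt0; rewrite /prog_prod big_ord_recr /=.
apply: leq_trans (leq_pmull _ (prog_prod_gt0 A n)).
by rewrite add1n ltnW // ltnS leq_pmull.
Qed.

(** Each factor contributes [ln (1 + A j) <= A j]. *)
Lemma ln_prog_prod (A n : nat) : (ln (INR (prog_prod A n)) <= INR A * INR n ^ 2)%R.
Proof.
elim: n => [|n IH]; first by rewrite /prog_prod big_ord0 ln_1 /=; lra.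
rewrite /prog_prod big_ord_recr -/(prog_prod A n) [nat_of_ord _]/= INR_mul S_INR.
have P_gt0 : (0 < INR (prog_prod A n))%R by apply/lt_0_INR/ltP/prog_prod_gt0.
have F_gt0 : (0 < INR (1 + A * n))%R by apply: lt_0_INR; lia.
rewrite ln_mult //.
have lnF : (ln (INR (1 + A * n)) <= INR A * INR n)%R.
  rewrite -[X in (_ <= X)%R](ln_exp (INR A * INR n)%R); apply: ln_le => //.
  apply: Rle_trans (exp_ineq1_le _).
  by rewrite -plusE plus_INR INR_mul /=; lra.
have := Rmult_le_pos _ _ (pos_INR A) (pos_INR n); have := pos_INR A; nra.
Qed.

(** Both [k >= 4] and [n >= 2] enter through [e <= 3]: they give [ln k > 1], so the square root is
    positive, and [L = ln (n + 1) >= 1]. Then [sqrt t <= 1 + t] at [t = ln (ln k) <= ln A + 2 L]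
    gives the bound. *)
Lemma sqrt_lnln_prog (A n : nat) (k := prog_prod A n) : 0 < A -> 2 <= n -> 4 <= k ->
  (0 < sqrt (ln (ln (INR k))) <= (3 + ln (INR A)) * ln (INR n.+1))%R.
Proof.
move=> A_gt0 n_ge2 k_ge4.
have A_ge1 : (1 <= INR A)%R by exact: (@leq_INR 1 A).
have lnA_ge0 : (0 <= ln (INR A))%R by rewrite -ln_1; apply: ln_le => //; lra.
have e_le3 := exp_le_3.
have k_gt3 : (3 < INR k)%R.
  by have := leq_INR k_ge4; rewrite (_ : INR 4 = 4%R) /=; lra.
have lnk_gt1 : (1 < ln (INR k))%R.
  by rewrite -[X in (X < _)%R](ln_exp 1); apply: ln_increasing; [exact: exp_pos | lra].
have lnlnk_gt0 : (0 < ln (ln (INR k)))%R by rewrite -ln_1; apply: ln_increasing; lra.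
split; first exact: sqrt_lt_R0.
have n_ge2' : (2 <= INR n)%R by exact: (@leq_INR 2 n).
have nS := S_INR n.
have L_ge1 : (1 <= ln (INR n.+1))%R.
  by rewrite -[X in (X <= _)%R](ln_exp 1); apply: ln_le; [exact: exp_pos | lra].
have lnlnk_le : (ln (ln (INR k)) <= ln (INR A) + 2 * ln (INR n.+1))%R.
  have lnn_le : (ln (INR n) <= ln (INR n.+1))%R by apply: ln_le; lra.
  have : (ln (ln (INR k)) <= ln (INR A * INR n ^ 2))%R.
    by apply: ln_le; [lra | exact: ln_prog_prod].
  by rewrite -Rsqr_pow2 /Rsqr !ln_mult; nra.
have sqrt_le : (sqrt (ln (ln (INR k))) <= 1 + ln (ln (INR k)))%R.
  have := sqrt_sqrt (ln (ln (INR k))); have := sqrt_pos (ln (ln (INR k))); nra.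
nra.
Qed.

Theorem theorem1p1 (f : {poly int}) (hf : pdeg f = 2%N) :
  (exists c : R, (0 < c)%R /\
     forall N : nat, exists g : {poly int},
       let k := pdeg g in
       (N <= k)%N /\ odd k /\
       irr_factors_deg_le (comp_poly g f) (c * INR k / sqrt (ln (ln (INR k))))%R)
  /\ (forall eps : R, (0 < eps)%R -> admits_polysmoothness f eps).
Proof.
set smooth := exists c : R, _.
suff smooth_f : smooth.
  split=> // eps eps_gt0; have [c [c_gt0 smooth_c]] := smooth_f.
  (* [c k / S <= 2 eps k] amounts to [S >= c / (2 eps)], where [S = sqrt (ln (ln k))]; this holds
     once [k] exceeds [exp (exp (X^2))]. *)
  pose X := (c / (2 * eps))%R.
  have X_gt0 : (0 < X)%R by apply: Rdiv_lt_0_compat; lra.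
  have [N N_gt] := INR_unbounded (exp (exp (X ^ 2))).
  have [g [N_le [k_odd g_smooth]]] := smooth_c N.
  exists g; split; first by case: (pdeg g) k_odd.
  rewrite hf => q q_irr q_dvd; apply: Rle_trans (g_smooth q q_irr q_dvd) _.
  set k := pdeg g in N_le *.
  have ltk : (exp (exp (X ^ 2)) < INR k)%R by have := leq_INR N_le; lra.
  have ltk1 : (exp (X ^ 2) < ln (INR k))%R.
    by rewrite -[X in (X < _)%R]ln_exp; apply: ln_increasing => //; apply: exp_pos.
  have ltk2 : (X ^ 2 < ln (ln (INR k)))%R.
    by rewrite -[X in (X < _)%R]ln_exp; apply: ln_increasing => //; apply: exp_pos.
  have X_lt : (X < sqrt (ln (ln (INR k))))%R.
    by rewrite -(sqrt_pow2 X); [apply: sqrt_lt_1_alt; split => //; apply: pow2_ge_0 | lra].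
  set S := sqrt _ in X_lt *.
  have S_gt0 : (0 < S)%R by lra.
  apply: (Rmult_le_reg_r S) => //.
  have -> : (c * INR k / S * S = X * (2 * eps * INR k))%R by rewrite /X; field; lra.
  have -> : (eps * INR 2 * INR k * S = S * (2 * eps * INR k))%R by rewrite /=; ring.
  apply: Rmult_le_compat_r; last by lra.
  by have := pos_INR k; nra.
have size_f : size f = 3 by move: hf; rewrite /pdeg; case: (size f) => // n /= ->.
have [A A_gt0 substitution] := smooth_substitution size_f.
have A_ge1 : (1 <= INR A)%R by exact: (@leq_INR 1 A).
have lnA_ge0 : (0 <= ln (INR A))%R by rewrite -ln_1; apply: ln_le => //; lra.
(* The 2 comes from the degree bound [2 phi(k)], [A + 1] from the totient estimate and [3 + ln A]
   from the bound on the square root. *)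
exists (2 * (INR A.+1 * (3 + ln (INR A))))%R; split.
  by rewrite S_INR; nra.
(* This [n] gives [k0 >= N + 4], which covers both [k0 >= N] and [k0 >= 4]. *)
move=> N; set n := (N + 4).+1; set k0 := prog_prod A n.
have k0_ge : N + 4 <= k0 by exact: prog_prod_ge.
have [k0_odd [g deg_g g_smooth]] := substitution n.
exists g; rewrite deg_g -/k0; split; first by apply: leq_trans k0_ge; apply: leq_addr.
split; first by [].
rewrite -/k0 in g_smooth *.
move=> q q_irr q_dvd; apply: Rle_trans (leq_INR (g_smooth q q_irr q_dvd)) _.
have [S_gt0 S_le] : (0 < sqrt (ln (ln (INR k0))) <= (3 + ln (INR A)) * ln (INR n.+1))%R.
  apply: sqrt_lnln_prog => //; first by rewrite /n addnS.
  by apply: leq_trans k0_ge; apply: leq_addl.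
have phi_le := totient_prog_bound n A_gt0; rewrite -/k0 in phi_le.
set S := sqrt _ in S_gt0 S_le *.
apply: (Rmult_le_reg_r S) => //.
rewrite /Rdiv Rmult_assoc Rinv_l; last by lra.
rewrite Rmult_1_r INR_mul.
have := Rmult_le_compat_l _ _ _ (pos_INR (totient k0)) S_le.
have C_ge0 : (0 <= 3 + ln (INR A))%R by lra.
have := Rmult_le_compat_l _ _ _ C_ge0 phi_le.
rewrite (_ : INR 2 = 2%R) //; nra.
Qed.
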